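(* Let $S^{(j)}=f_j(X^{(j)},U)$, $j=1,\dots,m$, where $f_j:\mathbb{R}^d\times\mathbb{R}\to\mathbb{R}$ and $U$ is a random variable independent of the data $X=(X^{(1)},\dots,X^{(m)})$, with $\mathbb{E}_0|S^{(j)}|\le M$ for some $M>0$ and all $j$. Let $C_m:\mathbb{R}^m\to\mathbb{R}$ satisfy, for some $L,p,q>0$, $|C_m(s)-C_m(s')|\le L\big(\sum_{j=1}^m|s_j-s'_j|^p\big)^q$ for all $s,s'\in\mathbb{R}^m$, and let $T_\alpha=\mathbf{1}\{C_m(S^{(1)},\dots,S^{(m)})\ge\kappa_\alpha\}$, with $\alpha\mapsto\kappa_\alpha$ strictly decreasing, satisfy $\mathbb{P}_0(T_\alpha=1)\le\alpha$. Suppose that $S^{(j)}$ is measurable with respect to $\sigma\big(U,(|X_1^{(j)}|,\dots,|X_d^{(j)}|)\big)$ for $j=1,\dots,m$. Then, for any $\alpha\in(0,0.1]$ there exists $c>0$, not depending on $n,m,d$, such that $$\sup_{f\in H_\rho}\mathbb{P}_f(T_\alpha=0)\ge 3/4$$ whenever $$\rho^2\le c\,\frac{\sqrt d}{\sqrt m\,n}.$$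
   Context: Model: for $n,m,d\in\mathbb{N}$ and unknown $f\in\mathbb{R}^d$, one observes $X^{(j)}=f+\frac{1}{\sqrt n}Z^{(j)}$, with $Z^{(j)}$ i.i.d. $N(0,I_d)$, $j=1,\dots,m$; $X_i^{(j)}$ is the $i$-th coordinate of $X^{(j)}$. $\mathbb{P}_f$ and $\mathbb{E}_f$ denote the joint law (including $U$, whose law does not depend on $f$) and expectation; $\mathbb{P}_0,\mathbb{E}_0$ correspond to $f=0$. For $\rho>0$, $H_\rho=\{f\in\mathbb{R}^d:\|f\|_2\ge\rho\}$; the null hypothesis is $f=0$. *)

(* Defs.v *)
From mathcomp Require Import all_boot all_order all_algebra.
From mathcomp Require Import all_classical all_reals all_analysis.

Set Implicit Arguments.
Unset Strict Implicit.
Unset Printing Implicit Defensive.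

Import Order.TTheory GRing.Theory Num.Theory.

Local Open Scope classical_set_scope.
Local Open Scope ring_scope.

(* The library's norm on 'rV[R]_d is the sup norm. *)
Definition norm2 (R : realType) (d : nat) (f : 'rV[R]_d) : R :=
  Num.sqrt (\sum_(i < d) f ord0 i ^+ 2).

Definition alternative (R : realType) (d : nat) (rho : R) : set 'rV[R]_d :=
  [set f | rho <= norm2 f].

Definition coords (R : realType) (Omega : Type) (d : nat)
    (X : Omega -> 'rV[R]_d) : set (Omega -> R) :=
  [set (fun w => X w ord0 i) | i in [set: 'I_d]].

Definition abs_coords (R : realType) (Omega : Type) (d : nat)
    (X : Omega -> 'rV[R]_d) : set (Omega -> R) :=
  [set (fun w => `|X w ord0 i|) | i in [set: 'I_d]].

(* The sigma-algebra on Omega generated by a set G of real-valued functions. *)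
Definition sigma_gen (R : realType) (Omega : Type) (G : set (Omega -> R)) :
    set (set Omega) :=
  <<s \bigcup_(g in G) preimage_set_system setT g measurable >>.

Definition measurable_wrt (R : realType) (Omega : Type)
    (F : set (set Omega)) (g : Omega -> R) : Prop :=
  forall B : set R, measurable B -> F (g @^-1` B).

Definition random_vector (R : realType) (disp : measure_display)
    (Omega : measurableType disp) (d : nat) (X : Omega -> 'rV[R]_d) : Prop :=
  forall i : 'I_d, measurable_fun setT (fun w => X w ord0 i).

Definition indep (R : realType) (disp : measure_display)
    (Omega : measurableType disp) (P : probability Omega R)
    (F G : set (set Omega)) : Prop :=
  forall A B : set Omega, F A -> G B -> (P (A `&` B) = P A * P B)%E.

Definition mutual_indep (R : realType) (disp : measure_display)
    (Omega : measurableType disp) (P : probability Omega R)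
    (I : finType) (F : I -> set (set Omega)) : Prop :=
  forall (J : {set I}) (A : I -> set Omega), (forall i, i \in J -> F i (A i)) ->
    P (\bigcap_(i in [set` J]) A i) = (\prod_(i in J) P (A i))%E.

(* Z has law N(0, I_d): its coordinates are independent N(0, 1) variables. *)
Definition standard_normal_vector (R : realType) (disp : measure_display)
    (Omega : measurableType disp) (P : probability Omega R) (d : nat)
    (Z : Omega -> 'rV[R]_d) : Prop :=
  [/\ random_vector Z,
      forall (i : 'I_d) (B : set R), measurable B ->
        P ((fun w => Z w ord0 i) @^-1` B) = normal_prob 0 1 B
    & mutual_indep P (fun i : 'I_d => sigma_gen [set (fun w => Z w ord0 i)])].

(* (P_f)_f is the family of joint laws of the data X and the auxiliary
   randomness U, all carried by one measurable space, so that statistics and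
   generated sigma-algebras do not depend on f while the noise Z does. *)
Definition gaussian_experiment (R : realType) (disp : measure_display)
    (Omega : measurableType disp) (n m d : nat)
    (P : 'rV[R]_d -> probability Omega R)
    (X : 'I_m -> Omega -> 'rV[R]_d) (U : Omega -> R) : Prop :=
  [/\ forall j, random_vector (X j),
      measurable_fun setT U
    & forall f : 'rV[R]_d,
      [/\ exists Z : 'I_m -> Omega -> 'rV[R]_d,
          [/\ forall j w, X j w = f + (Num.sqrt n%:R)^-1 *: Z j w,
              forall j, standard_normal_vector (P f) (Z j)
            & mutual_indep (P f) (fun j => sigma_gen (coords (Z j)))],
          indep (P f) (sigma_gen [set U])
            (sigma_gen (\bigcup_(j in [set: 'I_m]) coords (X j)))
        & forall B : set R, measurable B ->
          P f (U @^-1` B) = P 0 (U @^-1` B)]].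

Definition statistic (R : realType) (Omega : Type) (m d : nat)
    (fs : 'I_m -> 'rV[R]_d -> R -> R)
    (X : 'I_m -> Omega -> 'rV[R]_d) (U : Omega -> R) (j : 'I_m) : Omega -> R :=
  fun w => fs j (X j w) (U w).

Definition threshold_test (R : realType) (Omega : Type) (m : nat)
    (C : 'rV[R]_m -> R) (S : 'I_m -> Omega -> R) (kappa : R) : Omega -> R :=
  \1_[set w | kappa <= C (\row_(j < m) S j w)].

(* Main.v *)
Require Import Defs.
From HB Require Import structures.
From mathcomp Require Import all_boot all_order all_algebra.
From mathcomp Require Import all_classical all_reals all_analysis.
From mathcomp Require Import measurable_realfun.
From mathcomp Require Import ring lra.

(* Take [f] constant with norm [rho].  The test only sees [U] and the absolute
   values [|X_i^(j)|], which are independent under every [P_f]; so the law of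
   the observed data under [P_f] has a product density with respect to [P_0],
   with factors [exp (- t^2 / 2) cosh (t z)] where [t = sqrt n * rho / sqrt d].
   The second moment of that density is [cosh (t^2) ^ (m d)], at most
   [exp (2 m d t^4)], which is bounded by [6 / 5] as soon as [c <= 1 / 4].  A
   density this close to [1] in mean square cannot raise a rejection
   probability of at most [1 / 10] above [1 / 4].  Continuity of [C] makes the
   rejection event measurable. *)

Set Implicit Arguments.
Unset Strict Implicit.
Unset Printing Implicit Defensive.

Import Order.TTheory GRing.Theory Num.Theory.
Import numFieldNormedType.Exports.

Local Open Scope classical_set_scope.
Local Open Scope ring_scope.

(** * Integration against image measures and densities, and products of independent factors *)

Section density.
Import HBNNSimple.

(** The hypothesis on indicators extends to simple functions by linearity, then to nonnegative [g]
    by monotone convergence. Carrying both [Y] and [W] covers image measures ([W] constant 1) and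
    densities ([Y] the identity) at once. *)
Lemma ge0_integral_density (R : realType) (d d' : measure_display)
    (T : measurableType d) (T' : measurableType d')
    (mu : {measure set T -> \bar R}) (nu : {measure set T' -> \bar R})
    (Y : T -> T') (W : T -> R) :
  measurable_fun setT Y -> measurable_fun setT W -> (forall x, 0 <= W x) ->
  (forall B, measurable B -> nu B = (\int[mu]_x (\1_B (Y x) * W x)%:E)%E) ->
  forall g : T' -> R, measurable_fun setT g -> (forall y, 0 <= g y) ->
  (\int[nu]_y (g y)%:E = \int[mu]_x (g (Y x) * W x)%:E)%E.
Proof.
move=> mY mW W0 nuE g mg g0.
have mg' : measurable_fun [set: T'] (EFin \o g : T' -> \bar R)
  by exact/measurable_EFinP.
pose f_ := nnsfun_approx measurableT mg'.
have f_cvg y : (f_ n y)%:E @[n --> \oo] --> (g y)%:E.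
  by apply: (cvg_nnsfun_approx measurableT mg') => // t _; rewrite lee_fin.
have f_nd y : {homo (fun n => f_ n y) : m n / (m <= n)%N >-> m <= n}.
  by move=> m n mn; exact/lefP/nd_nnsfun_approx.
have mfY n : measurable_fun setT (fun x => f_ n (Y x) * W x).
  apply: measurable_funM => //; apply: measurableT_comp => //.
transitivity (limn (fun n => \int[nu]_y (f_ n y)%:E)%E).
  rewrite -monotone_convergence//.
  - by apply: eq_integral => y _; apply/esym/cvg_lim.
  - by move=> n; exact/measurable_EFinP/measurable_funP.
  - by move=> n y _; rewrite lee_fin.
  - by move=> y _ m n mn; rewrite lee_fin; exact: f_nd.
transitivity (limn (fun n => \int[mu]_x (f_ n (Y x) * W x)%:E)%E); last first.
  rewrite -monotone_convergence//.
  - apply: eq_integral => x _; apply/cvg_lim => //.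
    by rewrite EFinM; exact: (cvgeZr _ (f_cvg (Y x))).
  - by move=> n; exact/measurable_EFinP.
  - by move=> n x _; rewrite lee_fin mulr_ge0.
  - by move=> x _ m n mn; rewrite lee_fin ler_wpM2r// f_nd.
congr (limn _); apply/funext => n.
transitivity (\sum_(r \in range (f_ n)) r%:E * nu (f_ n @^-1` [set r]))%E.
  by rewrite integralT_nnsfun sintegralE.
transitivity (\sum_(r \in range (f_ n))
  \int[mu]_x (r * (\1_(f_ n @^-1` [set r]) (Y x) * W x))%:E)%E.
  apply: eq_fsbigr => r /set_mem [y _ <-].
  rewrite nuE//; under [RHS]eq_integral do rewrite EFinM.
  rewrite ge0_integralZl_EFin//.
  - by move=> x _; rewrite lee_fin mulr_ge0.
  - apply/measurable_EFinP/measurable_funM => //.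
    by apply: measurableT_comp => //.
rewrite -ge0_integral_fsum//.
- apply: eq_integral => x _; rewrite fsumEFin//; congr (_%:E).
  rewrite [in RHS]fimfunE /= mulr_fsuml; apply: eq_fsbigr => r _; by rewrite mulrA.

- move=> r; apply/measurable_EFinP/measurable_funM => //.
  by apply: measurable_funM => //; apply: measurableT_comp.
- move=> r x _; rewrite mulrA EFinM mule_ge0//; last by rewrite lee_fin.
  exact: nnfun_muleindic_ge0.
Qed.
End density.

(** Quantifying over full intersections suffices: taking some [B i] to be the whole line recovers
    every subfamily. *)
Definition indep_family (R : realType) (d : measure_display)
    (T : measurableType d) (P : probability T R) (I : finType)
    (V : I -> T -> R) : Prop :=
  forall B : I -> set R, (forall i, measurable (B i)) ->
    P (\bigcap_i (V i @^-1` B i)) = (\prod_i P (V i @^-1` B i))%E.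

Lemma indic_bigcap (R : pzRingType) (T : Type) (I : finType) (A : I -> set T)
    (t : T) :
  \1_(\bigcap_i A i) t = \prod_i \1_(A i) t :> R.
Proof.
rewrite indicE; have [tA|/negP tA] := boolP (t \in _).
  rewrite big1// => i _; rewrite indicE mem_set//.
  by move/set_mem : tA; exact.
have [i nAi] : exists i, ~ A i t.
  by apply/existsNP => At; apply: tA; apply/mem_set => i _; exact: At.
apply/esym/eqP; rewrite /=.
have -> : \prod_i \1_(A i) t = (\prod_i (t \in A i : nat))%:R :> R.
  by rewrite natr_prod; apply: eq_bigr.
by rewrite (bigD1 i)//= memNset.
Qed.

Lemma integral_indic_comp (R : realType) (d d' : measure_display)
    (T : measurableType d) (T' : measurableType d')
    (mu : {measure set T -> \bar R}) (Y : T -> T') (B : set T') :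
  measurable_fun setT Y -> measurable B ->
  (\int[mu]_x (\1_B (Y x))%:E = mu (Y @^-1` B))%E.
Proof.
move=> mY mB.
rewrite -[in RHS](setIT (Y @^-1` B)) -integral_indic//.
by rewrite -[_ @^-1` _]setTI; exact: mY.
Qed.

(** Independence is the product rule for indicators; the factors are then freed from being
    indicators one index at a time. *)
Lemma integral_prod_indep (R : realType) (d : measure_display)
    (T : measurableType d) (P : probability T R) (I : finType)
    (V : I -> T -> R) (g : I -> R -> R) (e : I -> R) :
  (forall i, measurable_fun setT (V i)) -> indep_family P V ->
  (forall i, measurable_fun setT (g i)) -> (forall i x, 0 <= g i x) ->
  (forall i, (\int[P]_w (g i (V i w))%:E = (e i)%:E)%E) ->
  (\int[P]_w (\prod_i g i (V i w))%:E = (\prod_i e i)%:E)%E.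
Proof.
move=> mV iV.
(* Induction on a list [s] of the indices whose factor may be arbitrary; outside [s] every factor is
   an indicator. *)
suff: forall s : seq I, forall (g : I -> R -> R) (e : I -> R),
    (forall i, measurable_fun setT (g i)) -> (forall i x, 0 <= g i x) ->
    (forall i, (\int[P]_w (g i (V i w))%:E = (e i)%:E)%E) ->
    (forall i, i \notin s -> exists2 B, measurable B & g i = \1_B) ->
    (\int[P]_w (\prod_i g i (V i w))%:E = (\prod_i e i)%:E)%E.
  move=> + mg g0 ge; move=> /(_ (enum I)); apply => // i.
  by rewrite mem_enum.
elim=> [|k s ih] {}g {}e mg g0 ge gB.
  have {gB}/choice[B gB] : forall i, exists B, measurable B /\ g i = \1_B.
    by move=> i; have [//|B mB gi] := gB i; exists B.
  have PB i : P (V i @^-1` B i) = (e i)%:E.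
    have [mB gi] := gB i.
    by rewrite -ge gi integral_indic_comp.
  under eq_integral.
    move=> w _.
    have -> : \prod_i g i (V i w) = \1_(\bigcap_i (V i @^-1` B i)) w.
      rewrite indic_bigcap; apply: eq_bigr => i _.
      by have [_ ->] := gB i.
    over.
  rewrite integral_indic//; last first.
    apply: fin_bigcap_measurable => // i _.
    by rewrite -[_ @^-1` _]setTI; apply: mV => //; have [] := gB i.
  rewrite setIT; apply: eq_trans (iV B _) _; first by move=> i; have [] := gB i.
  by rewrite -prodEFin; apply: eq_bigr.
pose W w := \prod_(i | i != k) g i (V i w).
pose c := \prod_(i | i != k) e i.
have e0 i : 0 <= e i.
  by rewrite -lee_fin -ge integral_ge0// => w _; rewrite lee_fin.
have c0 : 0 <= c by exact: prodr_ge0.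
have mW : measurable_fun setT W.
  rewrite /W; under eq_fun do rewrite -big_filter.
  by apply: measurable_prod => i _; exact: measurableT_comp.
have W0 w : 0 <= W w by exact: prodr_ge0.
transitivity (\int[P]_w (g k (V k w) * W w)%:E)%E.
  by apply: eq_integral => w _; rewrite (bigD1 k).
pose Vk : {RV P >-> R} := HB.pack (V k) (isMeasurableFun.Build _ _ _ _ _ (mV k)).
(* With factor [k] replaced by an indicator, the induction hypothesis says that [c] times the law of
   [V k] is the image under [V k] of [P] weighted by [W]. The density lemma then passes from
   indicators to [g k]. *)
pose nu := mscale (NngNum c0) (distribution P Vk).
rewrite -(@ge0_integral_density _ _ _ _ _ P nu (V k) W)//.
  rewrite ge0_integral_mscale//=; last 2 first.
  - exact/measurable_EFinP.
  - by move=> x _; rewrite lee_fin.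
  rewrite ge0_integral_distribution//=; last 2 first.
  - exact/measurable_EFinP.
  - by move=> x; rewrite lee_fin.
  by rewrite ge -EFinM [in RHS](bigD1 k)//= mulrC.
move=> B mB.
pose g' i := if i == k then \1_B else g i.
pose e' i := if i == k then fine (P (V k @^-1` B)) else e i.
transitivity (\prod_i e' i)%:E.
  rewrite (bigD1 k)//= /e' eqxx (eq_bigr e); last by move=> i /negPf ->.
  rewrite /nu /mscale/= /distribution /pushforward/= mulrC EFinM.
  rewrite fineK// fin_num_measure//.
  by rewrite -[_ @^-1` _]setTI; exact: (mV k).
rewrite -(ih g').
- apply: eq_integral => w _; rewrite (bigD1 k)//= /g' eqxx; congr (_ * _)%:E.
  by apply: eq_bigr => i /negPf ->.
- by move=> i; rewrite /g'; case: ifPn.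
- by move=> i x; rewrite /g'; case: ifPn.
- move=> i; rewrite /g' /e'; case: ifPn => [/eqP ->|//].
  rewrite integral_indic_comp// fineK// fin_num_measure//.
  by rewrite -[_ @^-1` _]setTI; exact: (mV k).
- move=> i nis; rewrite /g'; case: ifPn => [_|ik]; first by exists B.
  by apply: gB; rewrite inE (negPf ik).
Qed.

Lemma ge0_integral_mean (R : realType) (d : measure_display)
    (T : measurableType d) (m : {measure set T -> \bar R}) (f1 f2 : T -> R) :
  measurable_fun setT f1 -> measurable_fun setT f2 ->
  (forall x, 0 <= f1 x) -> (forall x, 0 <= f2 x) ->
  (\int[m]_x (f2 x)%:E = \int[m]_x (f1 x)%:E ->
   \int[m]_x (2^-1 * f1 x + 2^-1 * f2 x)%:E = \int[m]_x (f1 x)%:E)%E.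
Proof.
move=> /measurable_EFinP mf1 /measurable_EFinP mf2 f10 f20 f12.
under eq_integral do rewrite EFinD !EFinM.
rewrite ge0_integralD//; last 4 first.
- by move=> z _; rewrite mule_ge0 ?lee_fin.
- exact: measurable_funeM.
- by move=> z _; rewrite mule_ge0 ?lee_fin.
- exact: measurable_funeM.
have f1E x : setT x -> (0 <= (f1 x)%:E)%E by rewrite lee_fin.
have f2E x : setT x -> (0 <= (f2 x)%:E)%E by rewrite lee_fin.
rewrite !ge0_integralZl_EFin// f12 -ge0_muleDl//.
by rewrite -EFinD -div1r -splitr mul1e.
Qed.

(** * Folding a shifted normal variable: the law of its absolute value *)

Section gaussian.
Context {R : realType}.
Local Notation mu := (@lebesgue_measure R).
Local Notation phi := (normal_pdf (0 : R) 1).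

Lemma normal_pdf01 (x : R) : phi x = normal_peak 1 * expR (- (x ^+ 2 / 2)).
Proof.
by rewrite normal_pdfE ?oner_neq0// /normal_fun subr0 expr1n mulNr.
Qed.

Lemma ge0_integral_normal_prob (g : R -> R) (m s : R) :
  measurable_fun setT g -> (forall x, 0 <= g x) ->
  (\int[normal_prob m s]_x (g x)%:E =
   \int[mu]_x (g x * normal_pdf m s x)%:E)%E.
Proof.
move=> mg g0; apply: (ge0_integral_density (Y := id)) => //.
- exact: measurable_normal_pdf.
- by move=> x; exact: normal_pdf_ge0.
- move=> B mB.
  transitivity (\int[mu]_(x in B) (normal_pdf m s x)%:E)%E; first by [].
  rewrite [LHS]integral_mkcond; apply: eq_integral => x _.
  rewrite patchE indicE.
  by case: ifP => _; rewrite ?mul1r ?mul0r.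
Qed.

(** The image of Lebesgue measure under a translation gives each interval []b, c]] its length, so
    uniqueness applies. *)
Lemma lebesgue_measure_shift (a : R) (A : set R) : measurable A ->
  mu ((fun x => x + a) @^-1` A) = mu A.
Proof.
move=> mA.
have ms : measurable_fun setT
    (fun x : measurableTypeR R => x + a : measurableTypeR R).
  exact: measurable_funD.
pose sh : {mfun measurableTypeR R >-> measurableTypeR R} :=
  HB.pack (fun x => x + a) (isMeasurableFun.Build _ _ _ _ _ ms).
apply/esym; apply: (@lebesgue_measure_unique _ (pushforward mu sh)) => //.
move=> _ [[b c]] _ <- /=.
rewrite /pushforward /=.
have -> : [set` `]b, c]] = [set` `]b, c]] :> set R by [].
have -> : (fun x => x + a) @^-1` `]b, c] = `]b - a, c - a]%classic.
  by apply/seteqP; split=> x /=; rewrite !in_itv/= ltrBlDr lerBrDr.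
rewrite !lebesgue_measure_itv/= !lte_fin ltrD2r.
by case: ifP => // _; rewrite -!EFinD; congr EFin; ring.
Qed.

Lemma ge0_integral_shift (a : R) (g : R -> R) :
  measurable_fun setT g -> (forall x, 0 <= g x) ->
  (\int[mu]_x (g x)%:E = \int[mu]_x (g (x + a))%:E)%E.
Proof.
move=> mg g0.
rewrite (@ge0_integral_density _ _ _ _ _ mu mu (fun x => x + a) (cst 1))//=.
- by under eq_integral do rewrite mulr1.
- exact: measurable_funD.
- move=> B mB; under eq_integral do rewrite mulr1.
  rewrite integral_indic_comp//; last exact: measurable_funD.
  by apply/esym; exact: lebesgue_measure_shift.
Qed.

Lemma ge0_integral_reflect (g : R -> R) :
  measurable_fun setT g -> (forall x, 0 <= g x) ->
  (\int[mu]_x (g x)%:E = \int[mu]_x (g (- x))%:E)%E.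
Proof.
move=> mg g0.
rewrite (@ge0_integral_density _ _ _ _ _ mu mu -%R (cst 1))//=.
- by under eq_integral do rewrite mulr1.
- move=> B mB; under eq_integral do rewrite mulr1.
  by rewrite integral_indic_comp// -lebesgue_measureN.
Qed.

(* The density of the law of |t + Z| with respect to that of |Z|. *)
Definition fold_lr (t z : R) : R :=
  expR (- (t ^+ 2 / 2)) * ((expR (t * z) + expR (- (t * z))) / 2).

Lemma fold_lr_ge0 t z : 0 <= fold_lr t z.
Proof. by rewrite mulr_ge0 ?divr_ge0 ?addr_ge0 ?expR_ge0. Qed.

Lemma fold_lr_norm t z : fold_lr t `|z| = fold_lr t z.
Proof.
by case: (ger0P z) => // _; rewrite /fold_lr mulrN opprK (addrC (expR (- _))).
Qed.

Lemma measurable_fold_lr t : measurable_fun setT (fold_lr t).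
Proof.
have mt : measurable_fun setT (fun z : R => t * z) by exact: measurable_funM.
have mNt : measurable_fun setT (fun z : R => - (t * z)).
  exact: measurableT_comp mt.
do 2 apply: measurable_funM => //.
by apply: measurable_funD; apply: measurableT_comp.
Qed.

(** Completing the square: weighting the normal density by [fold_lr t] yields the equal mixture of
    the normal densities centred at [t] and [- t]. *)
Lemma fold_lr_pdf t z :
  fold_lr t z * phi z = 2^-1 * phi (z - t) + 2^-1 * phi (z + t).
Proof.
rewrite !normal_pdf01 /fold_lr.
have -> : - ((z - t) ^+ 2 / 2) = - (z ^+ 2 / 2) + - (t ^+ 2 / 2) + t * z by field.
have -> : - ((z + t) ^+ 2 / 2) = - (z ^+ 2 / 2) + - (t ^+ 2 / 2) - t * z by field.
by rewrite !expRD; field.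
Qed.

Lemma phiN z : phi (- z) = phi z.
Proof. by rewrite !normal_pdf01 sqrrN. Qed.

(** A function of [|z|] does not distinguish the two components of that mixture, so both may be
    replaced by the one centred at [t]; a translation then turns [z] into [t + z]. *)
Lemma integral_fold_lr (t : R) (g : R -> R) :
  measurable_fun setT g -> (forall x, 0 <= g x) ->
  (\int[normal_prob 0 1]_z (g `|z| * fold_lr t z)%:E =
   \int[normal_prob 0 1]_z (g `|t + z|)%:E)%E.
Proof.
move=> mg g0.
have phi0 x : 0 <= phi x by exact: normal_pdf_ge0.
have mphi : measurable_fun setT phi := measurable_normal_pdf _ _.
have mn : measurable_fun setT (fun z : R => g `|z|).
  by apply: measurableT_comp => //; exact: measurable_normr.
have mga (a : R) : measurable_fun setT (fun z : R => g `|z| * phi (z + a)).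
  apply: measurable_funM => //; apply: measurableT_comp => //.
  exact: measurable_funD.
have msh : measurable_fun setT (fun z : R => g `|t + z|).
  apply: measurableT_comp => //; apply: measurableT_comp => //.
  exact: measurable_funD.
rewrite !ge0_integral_normal_prob//; last 2 first.
- by apply: measurable_funM => //; exact: measurable_fold_lr.
- by move=> z; rewrite mulr_ge0// fold_lr_ge0.
(* Reflection [z] to [- z] exchanges the two components, [phi] being even. *)
have N : (\int[mu]_z (g `|z| * phi (z + t))%:E =
    \int[mu]_z (g `|z| * phi (z - t))%:E)%E.
  rewrite [LHS](ge0_integral_reflect (mga t)); last first.
    by move=> x; rewrite mulr_ge0.
  apply: eq_integral => z _; rewrite normrN; congr (_ * _)%:E.
  by rewrite -phiN; congr phi; ring.
have h0 (a z : R) : 0 <= g `|z| * phi (z + a) by rewrite mulr_ge0.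
transitivity (\int[mu]_z (g `|z| * phi (z - t))%:E)%E.
  rewrite -[RHS](@ge0_integral_mean _ _ _ mu _ _ (mga (- t)) (mga t)
    (h0 (- t)) (h0 t) N).
  apply: eq_integral => z _; congr EFin.
  by rewrite -mulrA fold_lr_pdf; ring.
rewrite [LHS](ge0_integral_shift t (mga (- t)) (h0 (- t))).
apply: eq_integral => z _; congr (_ * _)%:E; first by rewrite addrC.
by congr phi; ring.
Qed.

End gaussian.

(** * Moments of the folded likelihood ratio *)

Section moments.
Context {R : realType}.

Lemma integral_probability_cst (d : measure_display) (T : measurableType d)
    (P : probability T R) (c : R) :
  (\int[P]_x c%:E = c%:E)%E.
Proof.
have -> : (\int[P]_x c%:E = c%:E * P setT)%E by exact: integral_cst.
by rewrite probability_setT mule1.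
Qed.

Lemma integral_fold_lr1 (t : R) :
  (\int[normal_prob 0 1]_z (fold_lr t z)%:E = 1)%E.
Proof.
have := @integral_fold_lr R t (cst 1) (measurable_cst _) (fun=> ler01).
under eq_integral do rewrite mul1r; move=> ->.
exact: integral_probability_cst.
Qed.

(** This is [cosh u ^ 2 = (1 + cosh (2 u)) / 2] with [u = t * z], arranged so that the varying part
    is a multiple of [fold_lr (2 * t)], whose integral is 1. *)
Lemma fold_lr_sq (t z : R) : fold_lr t z ^+ 2 =
  expR (- (t ^+ 2)) / 2 + expR (t ^+ 2) / 2 * fold_lr (2 * t) z.
Proof.
rewrite /fold_lr.
have -> : - ((2 * t) ^+ 2 / 2) = - t ^+ 2 + - t ^+ 2 by field.
have -> : 2 * t * z = t * z + t * z by ring.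
rewrite opprD !expRD exprMn -[X in X * _]expRM_natl.
have -> : 2 * - (t ^+ 2 / 2) = - t ^+ 2 by field.
have e1 : expR (t * z) * expR (- (t * z)) = 1 by rewrite -expRD subrr expR0.
have e2 : expR (t ^+ 2) * expR (- t ^+ 2) = 1 by rewrite -expRD subrr expR0.
transitivity (expR (- t ^+ 2) / 2 * (expR (t * z) * expR (- (t * z))) +
  expR (- t ^+ 2) * ((expR (t * z) ^+ 2 + expR (- (t * z)) ^+ 2) / 4)).
  by field.
rewrite e1 mulr1; congr (_ + _).
transitivity ((expR (t ^+ 2) * expR (- t ^+ 2)) * (expR (- t ^+ 2) *
  ((expR (t * z) ^+ 2 + expR (- (t * z)) ^+ 2) / 4))); last by field.
by rewrite e2 mul1r.
Qed.

Lemma integral_fold_lr_sq (t : R) :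
  (\int[normal_prob 0 1]_z (fold_lr t z ^+ 2)%:E =
   ((expR (t ^+ 2) + expR (- (t ^+ 2))) / 2)%:E)%E.
Proof.
under eq_integral do rewrite fold_lr_sq EFinD (EFinM (expR (t ^+ 2) / 2)).
rewrite ge0_integralD//.
- rewrite integral_probability_cst ge0_integralZl_EFin//.
  + by rewrite integral_fold_lr1 mule1 -EFinD -mulrDl addrC.
  + by move=> z _; rewrite lee_fin fold_lr_ge0.
  + by apply/measurable_EFinP; exact: measurable_fold_lr.
- by move=> z _; rewrite lee_fin ?mulr_ge0 ?expR_ge0.
- by apply: measurable_funeM; apply/measurable_EFinP; exact: measurable_fold_lr.
Qed.

(** Only [1 + y <= exp y] is used: it bounds [exp x] and [exp (- x)] by [1 / (1 - x)] and
    [1 / (1 + x)], whose mean is [1 / (1 - x^2)]. For [x <= 1 / 2] this is at most [1 + 2 x^2],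
    hence at most [exp (2 x^2)]. *)
Lemma cosh_le (x : R) : 0 <= x -> x <= 1 / 2 ->
  (expR x + expR (- x)) / 2 <= expR (2 * x ^+ 2).
Proof.
move=> x0 x1.
have ub (y : R) : - 1 < y -> expR (- y) <= (1 + y)^-1.
  move=> y1; rewrite expRN lef_pV2 ?posrE ?expR_gt0 ?expR_ge1Dx//; lra.
have h1 := ub x ltac:(lra).
have h2 := ub (- x) ltac:(lra); rewrite opprK in h2.
apply: le_trans (expR_ge1Dx _).
apply: (@le_trans _ _ (((1 - x)^-1 + (1 + x)^-1) / 2)); first by lra.
have x2 : 0 <= x ^+ 2 <= 1 / 4.
  by rewrite sqr_ge0 expr2; nra.
have -> : ((1 - x)^-1 + (1 + x)^-1) / 2 = (1 - x ^+ 2)^-1.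
  by field; do ?[apply/andP; split]; apply: lt0r_neq0; nra.
by rewrite -[X in X <= _]div1r ler_pdivrMr; nra.
Qed.
End moments.

(** * Product likelihood ratios, the second-moment inequality and measurability of the rejection
    event *)

(** A pi-lambda argument. On cylinder events [Q A] factorizes by independence under [Q], and the
    integral by independence under [P]; the factors agree by the one-dimensional hypothesis. *)
Lemma likelihood_ratio_prod (R : realType) (d : measure_display)
    (T : measurableType d) (P Q : probability T R) (I : finType)
    (V : I -> T -> R) (ell : I -> R -> R) :
  (forall i, measurable_fun setT (V i)) ->
  indep_family P V -> indep_family Q V ->
  (forall i, measurable_fun setT (ell i)) -> (forall i x, 0 <= ell i x) ->
  (forall i B, measurable B ->
    (Q (V i @^-1` B) = \int[P]_w (\1_B (V i w) * ell i (V i w))%:E)%E) ->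
  forall A, sigma_gen (range V) A ->
    measurable A /\ (Q A = \int[P]_(w in A) (\prod_i ell i (V i w))%:E)%E.
Proof.
move=> mV iP iQ mell ell0 QV.
pose L w := \prod_i ell i (V i w).
have mL : measurable_fun setT (EFin \o L).
  apply/measurable_EFinP; apply: measurable_prod => i _.
  exact: measurableT_comp.
have L0 w : (0 <= (L w)%:E)%E by rewrite lee_fin prodr_ge0.
pose G : set (set T) := [set A | exists2 B : I -> set R,
  (forall i, measurable (B i)) & A = \bigcap_i (V i @^-1` B i)].
have mVB i B : measurable B -> measurable (V i @^-1` B).
  by move=> mB; rewrite -[_ @^-1` _]setTI; exact: mV.
pose D : set (set T) :=
  [set A | measurable A /\ (Q A = \int[P]_(w in A) (L w)%:E)%E].
have GD : G `<=` D.
  move=> _ [B mB ->]; split.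
    by apply: fin_bigcap_measurable => // i _; exact: mVB.
  rewrite iQ// integral_mkcond.
  transitivity (\int[P]_w (\prod_i (\1_(B i) (V i w) * ell i (V i w)))%:E)%E.
    rewrite (@integral_prod_indep _ _ _ P I V (fun i x => \1_(B i) x * ell i x)
      (fun i => fine (Q (V i @^-1` B i))))//.
    - rewrite -prodEFin; apply: eq_bigr => i _; rewrite fineK// fin_num_measure//.
      exact: mVB.
    - by move=> i; apply: measurable_funM.
    - by move=> i x; rewrite mulr_ge0.
    - by move=> i; rewrite -QV// fineK// fin_num_measure//; exact: mVB.
  apply: eq_integral => w _; rewrite big_split/=.
  rewrite -(indic_bigcap _ (fun i => V i @^-1` B i)) patchE indicE.
  by case: ifP => _; rewrite ?mul1r ?mul0r.
have GT : G setT.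
  by exists (fun=> setT) => //; apply/esym; rewrite -subTset => w _ i _.
have dD : dynkin D.
  split; first exact: GD.
  - move=> A [mA QA]; split; first exact: measurableC.
    (* The whole space is a cylinder, so the density has total mass 1; complements follow by
       subtraction. *)
    have [_] := GD _ GT; rewrite -(setUv A) ge0_integral_setU//=; last 3 first.
    - exact: measurableC.
    - by rewrite setUv.
    - by apply/disj_setPS; rewrite setICr.
    rewrite setUv probability_setT -QA => h.
    by rewrite probability_setC// h addeAC subee ?add0e// fin_num_measure.
  - move=> F tF DF; have mF n : measurable (F n) by case: (DF n).
    split; first exact: bigcup_measurable.
    rewrite ge0_integral_bigcup//; last exact: measurable_funTS.
    rewrite measure_bigcup//.
    apply/congr_lim/funext => n; apply: eq_big => [i|i _]; first exact: in_setT.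
    by case: (DF i).
have GI : setI_closed G.
  move=> _ _ [A mA ->] [B mB ->]; exists (fun i => A i `&` B i).
    by move=> i; exact: measurableI.
  by rewrite -bigcapI.
move=> A sA; suff: <<s G >> A.
  rewrite -setI_closed_g_dynkin_g_sigma_algebra// => dA.
  by apply: (dA D); split.
apply: sA; split; first exact: smallest_sigma_algebra.
move=> _ [_ [i _ <-]] [B mB <-]; apply: sub_sigma_algebra.
(* A generator constrains one coordinate only: it is the cylinder whose other sides are the whole
   line. *)
exists (fun j => if j == i then B else setT) => [j|]; first by case: ifP.
rewrite setTI; apply/seteqP; split => w /=.
  by move=> ? j _ /=; case: ifP => // /eqP ->.
by move=> /(_ i Logic.I); rewrite /= eqxx.
Qed.

(* Pointwise, [ell * 1_A + ell <= 1/2 + 3/2 * 1_A + ell^2 / 2]. *)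
Lemma second_moment_bound (R : realType) (d : measure_display)
    (T : measurableType d) (P Q : probability T R) (ell : T -> R) (A : set T)
    (v : R) :
  measurable_fun setT ell -> (forall w, 0 <= ell w) -> measurable A ->
  (Q A = \int[P]_(w in A) (ell w)%:E)%E -> (\int[P]_w (ell w)%:E = 1)%E ->
  (\int[P]_w (ell w ^+ 2)%:E <= (1 + v)%:E)%E ->
  (Q A <= (3 / 2)%:E * P A + (v / 2)%:E)%E.
Proof.
move=> mell ell0 mA QA ell1 ell2.
have mE : measurable_fun setT (EFin \o ell) by exact/measurable_EFinP.
have mI : measurable_fun setT (fun w => (\1_A w : R)%:E).
  by apply/measurable_EFinP.
have mS : measurable_fun setT (fun w => (ell w ^+ 2)%:E).
  by apply/measurable_EFinP; exact: measurable_funX.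
have mIE : measurable_fun setT (fun w => (\1_A w * ell w)%:E).
  by apply/measurable_EFinP; exact: measurable_funM.
have : (\int[P]_w ((\1_A w * ell w)%:E + (ell w)%:E) <=
    \int[P]_w ((1 / 2)%:E + ((3 / 2)%:E * (\1_A w)%:E +
      (1 / 2)%:E * (ell w ^+ 2)%:E)))%E.
  apply: ge0_le_integral => //.
  - by move=> w _; rewrite lee_fin addr_ge0 ?mulr_ge0.
  - exact: emeasurable_funD.
  - by apply: emeasurable_funD => //; apply: emeasurable_funD;
      exact: measurable_funeM.
  - move=> w _; rewrite -!EFinM -!EFinD lee_fin indicE.
    (* On [A] the inequality is [(ell - 2)^2 >= 0]; off [A] it is [(ell - 1)^2 >= 0]. *)
    have := sqr_ge0 (ell w - 2); have := sqr_ge0 (ell w - 1); rewrite !expr2.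
    by case: (w \in A) => /=; lra.
have i0 w : setT w -> (0 <= (\1_A w : R)%:E)%E by rewrite lee_fin.
have s0 w : setT w -> (0 <= (ell w ^+ 2)%:E)%E by rewrite lee_fin sqr_ge0.
have h0 : 0 <= 1 / 2 :> R by lra.
have h1 : 0 <= 3 / 2 :> R by lra.
rewrite ge0_integralD//; last 2 first.
- by move=> w _; rewrite lee_fin mulr_ge0.
- by move=> w _; rewrite lee_fin.
have -> : (\int[P]_w (\1_A w * ell w)%:E = Q A)%E.
  rewrite QA [RHS]integral_mkcond; apply: eq_integral => w _.
  by rewrite patchE indicE; case: ifP => _; rewrite ?mul1r ?mul0r.
rewrite ell1 ge0_integralD//; last 2 first.
- by move=> w _; rewrite -!EFinM -EFinD lee_fin addr_ge0// mulr_ge0// sqr_ge0.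
- by apply: emeasurable_funD; exact: measurable_funeM.
rewrite integral_probability_cst ge0_integralD//; last 3 first.
- exact: measurable_funeM.
- by move=> w _; rewrite -EFinM lee_fin mulr_ge0// sqr_ge0.
- exact: measurable_funeM.
have I1 : (\int[P]_w (\1_A w)%:E = P A)%E by rewrite integral_indic// setIT.
rewrite !ge0_integralZl_EFin// I1.
have [a Pa] : exists a, P A = a%:E.
  by exists (fine (P A)); rewrite fineK// fin_num_measure.
have [b Qb] : exists b, Q A = b%:E.
  by exists (fine (Q A)); rewrite fineK// fin_num_measure.
have [s Es] : exists s, (\int[P]_w (ell w ^+ 2)%:E = s%:E)%E.
  exists (fine (\int[P]_w (ell w ^+ 2)%:E)%E); rewrite fineK// fin_real//.
  by rewrite (lt_le_trans ltNy0 (integral_ge0 _ _))//= (le_lt_trans ell2)// ltry.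
move: ell2; rewrite Es Pa Qb -!EFinM -!EFinD !lee_fin => ? ?; lra.
Qed.

(* [C s < k] is an open condition; it is tested on rational points [r], with
   the slack given by the modulus of continuity of [C]. *)
Lemma measurable_rejection (R : realType) (d : measure_display)
    (T : measurableType d) (m : nat) (C : 'rV[R]_m -> R) (S : 'I_m -> T -> R)
    (L p q k : R) :
  0 < L -> 0 < p -> 0 < q ->
  (forall s s' : 'rV[R]_m, `|C s - C s'| <=
     L * (\sum_(j < m) `|s ord0 j - s' ord0 j| `^ p) `^ q) ->
  (forall j, measurable_fun setT (S j)) ->
  measurable [set w | k <= C (\row_j S j w)].
Proof.
move=> L0 p0 q0 CL mS.
pose dist (s r : 'I_m -> R) := L * (\sum_(j < m) `|s j - r j| `^ p) `^ q.
have CLd s r : `|C (\row_j s j) - C (\row_j r j)| <= dist s r.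
  apply: le_trans (CL _ _) _.
  by under eq_bigr do rewrite !mxE.
have approx (s : 'I_m -> R) (e : R) : 0 < e ->
    exists r : {ffun 'I_m -> rat}, dist s (fun j => ratr (r j)) < e.
  (* [t] solves [L * t^q = e / 2], and [u] below solves [u^p = t / (m + 1)], so that [m] terms of
     size at most [u^p] sum to at most [t]. Using [m + 1] avoids a division by zero when [m = 0]. *)
  move=> e0; pose t := (e / (2 * L)) `^ q^-1.
  have t0 : 0 < t by rewrite powR_gt0// divr_gt0// mulr_gt0.
  pose u := (t / m.+1%:R) `^ p^-1.
  have u0 : 0 < u by rewrite powR_gt0// divr_gt0.
  have /choice[r rP] : forall j, exists r : rat, `|s j - ratr r| < u.
    move=> j; have /rat_in_itvoo[r] : s j < s j + u by rewrite ltrDl.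
    rewrite in_itv/= => /andP[r1 r2]; exists r.
    by rewrite ltr_distlC; apply/andP; split; lra.
  exists (finfun r); apply: (@le_lt_trans _ _ (e / 2)); last by lra.
  have -> : e / 2 = L * (e / (2 * L)) by field; exact: lt0r_neq0.
  rewrite /dist ler_pM2l//.
  have <- : t `^ q = e * (2 * L)^-1.
    rewrite -powRrM mulVf ?gt_eqF// powRr1// divr_ge0 ?mulr_ge0 ?ltW//.
  apply: ge0_ler_powR; rewrite ?nnegrE.
  - exact: ltW.
  - by apply: sumr_ge0 => j _; exact: powR_ge0.
  - exact: ltW.
  apply: (@le_trans _ _ (\sum_(j < m) t / m.+1%:R)).
    apply: ler_sum => j _; rewrite ffunE.
    have <- : u `^ p = t / m.+1%:R.
      by rewrite -powRrM mulVf ?gt_eqF// powRr1// divr_ge0 ?ltW.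
    apply: ge0_ler_powR; rewrite ?nnegrE ?normr_ge0//; first exact: ltW.
    - exact: ltW.
    - exact/ltW/rP.
  rewrite sumr_const card_ord -(mulr_natl (t / _)) mulrCA ger_pMr//.
  by rewrite ler_pdivrMr// mul1r ler_nat.
(* For fixed [r], the point [w] enters only through [dist], which is explicitly measurable, and the
   index set of the [F r] is countable. *)
pose F (r : {ffun 'I_m -> rat}) := [set w |
  C (\row_j ratr (r j)) + dist (fun j => S j w) (fun j => ratr (r j)) < k].
have -> : [set w | k <= C (\row_j S j w)] = ~` \bigcup_r F r.
  apply/seteqP; split=> w /=.
    move=> kC [r _] /= Fr; have := CLd (fun j => S j w) (fun j => ratr (r j)).
    rewrite /= ler_norml => /andP[_ ?]; rewrite /F /= in Fr; lra.
  move=> nF; rewrite leNgt; apply/negP => Ck; apply: nF.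
  (* Half the gap, since the distance to [r] is paid twice: in passing from [C] at [S] to [C] at
     [r], and as the slack in [F r]. *)
  have e0 : 0 < (k - C (\row_j S j w)) / 2 by lra.
  have [r re] := approx (fun j => S j w) _ e0.
  exists r => //; rewrite /F /=; have := CLd (fun j => S j w) (fun j => ratr (r j)).
  rewrite /= ler_norml => /andP[? _]; lra.
apply: measurableC; apply: countable_bigcupT_measurable => [|r].
  exact: countableP.
have mF : measurable_fun setT (fun w =>
    C (\row_j ratr (r j)) + dist (fun j => S j w) (fun j => ratr (r j))).
  apply: measurable_funD => //; apply: measurable_funM => //.
  apply: (measurableT_comp (measurable_powR q)).
  apply: measurable_sum => j; apply: (measurableT_comp (measurable_powR p)).
  apply: measurableT_comp => //; exact: measurable_funB.
have := mF measurableT `]-oo, k[%classic (measurable_itv _).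
by rewrite setTI; congr (measurable _); apply/seteqP; split=> w /=; rewrite in_itv.
Qed.

(** * Generated sigma-algebras and transfer from normal variables and independent families *)

Section sigma_gen.
Context {R : realType} {T : pointedType}.
Implicit Types (G : set (T -> R)).

Lemma sigma_gen_comp G (g : T -> R) (h : R -> R) (B : set R) : G g ->
  measurable_fun setT h -> measurable B -> sigma_gen G ((h \o g) @^-1` B).
Proof.
move=> Gg mh mB; apply: sub_sigma_algebra; exists g => //.
exists (h @^-1` B); last by rewrite setTI.
by rewrite -[_ @^-1` _]setTI; exact: mh.
Qed.

Lemma sigma_gen_bigcap G (I : finType) (A : I -> set T) :
  (forall i, sigma_gen G (A i)) -> sigma_gen G (\bigcap_i A i).
Proof.
move=> GA.
apply: (@fin_bigcap_measurable _ (g_sigma_algebraType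
  (\bigcup_(g in G) preimage_set_system setT g measurable)) _ setT A) => // i _.
exact: GA.
Qed.

Lemma sigma_gen_subset G G' : G `<=` G' -> sigma_gen G `<=` sigma_gen G'.
Proof.
move=> GG'; apply: smallest_sub; first exact: smallest_sigma_algebra.
move=> A [g Gg gA]; apply: sub_sigma_algebra.
by exists g => //; exact: GG'.
Qed.

End sigma_gen.

Lemma ge0_integral_normal (R : realType) (d : measure_display)
    (T : measurableType d) (P : {measure set T -> \bar R}) (Y : T -> R) (a s : R)
    (g : R -> R) :
  measurable_fun setT Y ->
  (forall B : set R, measurable B -> P (Y @^-1` B) = normal_prob a s B) ->
  measurable_fun setT g -> (forall y, 0 <= g y) ->
  (\int[P]_x (g (Y x))%:E = \int[normal_prob a s]_y (g y)%:E)%E.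
Proof.
move=> mY PY mg g0; apply/esym.
rewrite (@ge0_integral_density _ _ _ _ _ P (normal_prob a s) Y (cst 1))//.
- by under eq_integral do rewrite mulr1.
- move=> B mB; under eq_integral do rewrite mulr1.
  by rewrite integral_indic_comp// PY.
Qed.

Lemma mutual_indep_bigcap (R : realType) (d : measure_display)
    (T : measurableType d) (P : probability T R) (I : finType)
    (F : I -> set (set T)) (A : I -> set T) :
  mutual_indep P F -> (forall i, F i (A i)) ->
  (P (\bigcap_i A i) = \prod_i P (A i))%E.
Proof.
move=> iF FA; have := iF [set: I]%SET A (fun i _ => FA i).
rewrite (_ : [set` [set: I]%SET] = setT).
  by move=> ->; apply: eq_bigl => i; rewrite finset.in_setT.
by apply/seteqP; split=> i //= _; rewrite finset.in_setT.
Qed.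

(** * The Gaussian experiment reduced to [U] and the absolute values of the data *)

Section experiment.
Context {R : realType} {disp : measure_display} {Omega : measurableType disp}.
Variables (n m d : nat) (P : 'rV[R]_d -> probability Omega R).
Variables (X : 'I_m -> Omega -> 'rV[R]_d) (U : Omega -> R).
Hypothesis n_gt0 : (0 < n)%N.
Hypothesis experiment : gaussian_experiment n P X U.

(** [U] is indexed alongside the absolute values, so that everything the test observes forms one
    finite independent family. *)
Definition folded_data (k : unit + 'I_m * 'I_d) : Omega -> R :=
  match k with inl _ => U | inr (j, i) => fun w => `|X j w ord0 i| end.

(** The law of [U] is the same under every [P f], hence the factor 1. Multiplying by [sqrt n] brings
    the data to unit variance and the signal [a] to the shift of [fold_lr]. *)
Definition folded_data_lr (a : R) (k : unit + 'I_m * 'I_d) : R -> R :=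
  match k with
  | inl _ => cst 1
  | inr _ => fun x => fold_lr (Num.sqrt n%:R * a) (Num.sqrt n%:R * x)
  end.

Lemma sqrtn_gt0 : 0 < Num.sqrt n%:R :> R.
Proof. by rewrite sqrtr_gt0 ltr0n. Qed.

Lemma measurable_folded_data k : measurable_fun setT (folded_data k).
Proof.
have [mX mU _] := experiment; case: k => [_|[j i]] //=.
by apply: measurableT_comp => //; exact: mX.
Qed.

Lemma measurable_folded_data_lr a k : measurable_fun setT (folded_data_lr a k).
Proof.
case: k => [_|_] //=; apply: (measurableT_comp (measurable_fold_lr _)).
exact: measurable_funM.
Qed.

Lemma folded_data_lr_ge0 a k x : 0 <= folded_data_lr a k x.
Proof. by case: k => [_|_] //=; exact: fold_lr_ge0. Qed.

(** Three levels of independence are peeled off in turn: [U] from the data, the samples from each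
    other, and the coordinates within a sample. *)
Lemma folded_data_indep f : indep_family (P f) folded_data.
Proof.
have [mX mU /(_ f)[[Z [XZ nZ iZ]] iU _]] := experiment.
move=> B mB.
pose A j i := (fun w => X j w ord0 i) @^-1` ((fun x => `|x|) @^-1` B (inr (j, i))).
have mnB k : measurable ((fun x : R => `|x|) @^-1` B k).
  by rewrite -[_ @^-1` _]setTI; exact: (@normr_measurable R setT).
have -> : \bigcap_k (folded_data k @^-1` B k) =
    U @^-1` B (inl tt) `&` \bigcap_j \bigcap_i A j i.
  apply/seteqP; split=> w /=.
    move=> h; split; first exact: (h (inl tt)).
    by move=> j _ i _; exact: (h (inr (j, i))).
  move=> [hU hA] [[]|[j i]] _ //=; exact: hA.
(* Independence of samples and coordinates is given for the noise; writing [X] as an affine image of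
   [Z] places the events [A j i] in the sigma-algebras of the noise. *)
pose g i := fun x : R => f ord0 i + (Num.sqrt n%:R)^-1 * x.
have mg i : measurable_fun setT (g i).
  by apply: measurable_funD => //; exact: measurable_funM.
have AZ j i : A j i = (g i \o (fun w => Z j w ord0 i)) @^-1`
    ((fun x => `|x|) @^-1` B (inr (j, i))).
  by apply/seteqP; split=> w; rewrite /A /g /= XZ !mxE.
rewrite iU; last 2 first.
- by apply: (@sigma_gen_comp _ _ _ _ id).
- apply: sigma_gen_bigcap => j; apply: sigma_gen_bigcap => i.
  by apply: (@sigma_gen_comp _ _ _ _ id) => //; exists j => //; exists i.
rewrite big_sumType/= (big_pred1 tt); last by case.
congr (_ * _)%E.
rewrite (mutual_indep_bigcap iZ) => [|j]; last first.
  apply: sigma_gen_bigcap => i; rewrite AZ.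
  by apply: sigma_gen_comp => //; exists i.
transitivity (\prod_j \prod_i P f (A j i))%E; last first.
  by rewrite pair_bigA; apply: eq_bigr => -[].
apply: eq_bigr => j _; have [_ _ inZ] := nZ j.
apply: (mutual_indep_bigcap inZ) => i; rewrite AZ.
exact: sigma_gen_comp.
Qed.

(** The factor [1 / sqrt n] is taken out of the absolute value so that the shape [|t + z|] of
    [integral_fold_lr] appears. *)
Lemma folded_data_law f j i (B : set R) : measurable B ->
  (P f (folded_data (inr (j, i)) @^-1` B) =
   \int[normal_prob 0 1]_z
     (\1_B ((Num.sqrt n%:R)^-1 * `|Num.sqrt n%:R * f ord0 i + z|))%:E)%E.
Proof.
move=> mB; have [mX mU /(_ f)[[Z [XZ nZ iZ]] _ _]] := experiment.
have [mZ PZ _] := nZ j.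
rewrite -integral_indic_comp//; last exact: measurable_folded_data.
have mg : measurable_fun setT
   (fun z : R => \1_B ((Num.sqrt n%:R)^-1 * `|Num.sqrt n%:R * f ord0 i + z|) : R).
  apply: measurableT_comp => //; apply: measurable_funM => //.
  by apply: measurableT_comp => //; exact: measurable_funD.
apply: (eq_trans _ (ge0_integral_normal (mZ i) (PZ i) mg _)) => //.
apply: eq_integral => w _; congr (\1_B _)%:E.
rewrite /= XZ !mxE -[X in X * `|_|]gtr0_norm ?invr_gt0 ?sqrtn_gt0// -normrM.
by rewrite mulrDr mulrA mulVf ?mul1r// gt_eqF// sqrtn_gt0.
Qed.

Lemma folded_data_likelihood a k (B : set R) : measurable B ->
  (P (const_mx a) (folded_data k @^-1` B) =
   \int[P 0]_w (\1_B (folded_data k w) *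
     folded_data_lr a k (folded_data k w))%:E)%E.
Proof.
move=> mB; have [mX mU Pf] := experiment.
case: k => [[]|[j i]].
  have [_ _ -> //] := Pf (const_mx a); rewrite -integral_indic_comp//.
  by apply: eq_integral => w _; rewrite mulr1.
rewrite folded_data_law// mxE.
have mg : measurable_fun setT
    (fun y : R => \1_B ((Num.sqrt n%:R)^-1 * y) : R).
  apply: measurableT_comp => //; exact: measurable_funM.
have := integral_fold_lr (Num.sqrt n%:R * a) mg; move=> <-//.
(* The noise under [P 0] is in general another map than the noise under [P (const_mx a)]; the two
   sides are compared through the standard normal law. *)
have [[Z [XZ nZ iZ]] _ _] := Pf 0; have [mZ PZ _] := nZ j.
have mh : measurable_fun setT (fun z : R =>
    \1_B ((Num.sqrt n%:R)^-1 * `|z|) * fold_lr (Num.sqrt n%:R * a) z : R).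
  apply: measurable_funM; last exact: measurable_fold_lr.
  by apply: (measurableT_comp mg).
apply: (eq_trans (esym (ge0_integral_normal (mZ i) (PZ i) mh _))).
  by move=> z; rewrite mulr_ge0// fold_lr_ge0.
have s0 := sqrtn_gt0.
have XE w : `|X j w ord0 i| = (Num.sqrt n%:R)^-1 * `|Z j w ord0 i|.
  by rewrite XZ !mxE add0r normrM gtr0_norm ?invr_gt0.
apply: eq_integral => w _; congr EFin; rewrite /= XE; congr (_ * _).
by rewrite mulrA divff ?gt_eqF// mul1r fold_lr_norm.
Qed.

(** Each of the [m * d] absolute values contributes [cosh (n a^2)], and [U] contributes 1. *)
Lemma folded_data_lr_second_moment a :
  (\int[P 0]_w ((\prod_k folded_data_lr a k (folded_data k w)) ^+ 2)%:E =
   (((expR (n%:R * a ^+ 2) + expR (- (n%:R * a ^+ 2))) / 2) ^+ (m * d))%:E)%E.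
Proof.
have [mX mU /(_ 0)[[Z [XZ nZ iZ]] _ _]] := experiment.
under eq_integral do rewrite -prodrXl.
pose c := (expR (n%:R * a ^+ 2) + expR (- (n%:R * a ^+ 2))) / 2 : R.
rewrite (@integral_prod_indep _ _ _ (P 0) _ folded_data
  (fun k x => folded_data_lr a k x ^+ 2)
  (fun k => if k is inr _ then c else 1)).
- rewrite big_sumType/= (big_pred1 tt); last by case.
  by rewrite mul1r prodr_const card_prod !card_ord.
- exact: measurable_folded_data.
- exact: folded_data_indep.
- by move=> k; apply: measurable_funX; exact: measurable_folded_data_lr.
- by move=> k x; rewrite sqr_ge0.
case=> [[]|[j i]] /=.
  under eq_integral do rewrite expr1n.
  exact: integral_probability_cst.
have [mZ PZ _] := nZ j.
have mh : measurable_fun setT (fun z : R => fold_lr (Num.sqrt n%:R * a) z ^+ 2).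
  by apply: measurable_funX; exact: measurable_fold_lr.
have -> : c%:E = (\int[normal_prob 0 1]_z (fold_lr (Num.sqrt n%:R * a) z ^+ 2)%:E)%E.
  by rewrite integral_fold_lr_sq exprMn sqr_sqrtr.
apply: (eq_trans _ (ge0_integral_normal (mZ i) (PZ i) mh _)); last first.
  by move=> z; rewrite sqr_ge0.
have s0 := sqrtn_gt0.
have XE w : `|X j w ord0 i| = (Num.sqrt n%:R)^-1 * `|Z j w ord0 i|.
  by rewrite XZ !mxE add0r normrM gtr0_norm ?invr_gt0.
apply: eq_integral => w _; congr ((_ ^+ 2)%:E).
by rewrite XE mulrA divff ?gt_eqF// mul1r fold_lr_norm.
Qed.

End experiment.

Lemma norm2_const (R : realType) (d : nat) (a : R) :
  norm2 (const_mx a : 'rV[R]_d) = Num.sqrt d%:R * `|a|.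
Proof.
rewrite /norm2; under eq_bigr do rewrite mxE.
by rewrite sumr_const card_ord -(mulr_natl (a ^+ 2)) sqrtrM// sqrtr_sqr.
Qed.

(** With [x = n a^2] the assumption reads [x * sqrt d * sqrt m <= 1 / 4]. Then [cosh x ^ (m d) <=
    exp (2 m d x^2) <= exp (1 / 8)], which is below [6 / 5] because [exp (- 1 / 8) >= 7 / 8]. *)
Lemma folded_data_lr_bound (R : realType) (n m d : nat) (rho a : R) :
  (0 < n)%N -> (0 < m)%N -> (0 < d)%N ->
  rho ^+ 2 = d%:R * a ^+ 2 ->
  rho ^+ 2 <= 1 / 4 * (Num.sqrt d%:R / (Num.sqrt m%:R * n%:R)) ->
  ((expR (n%:R * a ^+ 2) + expR (- (n%:R * a ^+ 2))) / 2) ^+ (m * d) <=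
    1 + 1 / 5 :> R.
Proof.
move=> n0 m0 d0 rhoE rho_le; set x := n%:R * a ^+ 2.
have x0 : 0 <= x by rewrite mulr_ge0// sqr_ge0.
have n0' : (0 : R) < n%:R by rewrite ltr0n.
have sd : (0 : R) < Num.sqrt d%:R by rewrite sqrtr_gt0 ltr0n.
have sm : (0 : R) < Num.sqrt m%:R by rewrite sqrtr_gt0 ltr0n.
have sd2 : Num.sqrt d%:R ^+ 2 = d%:R :> R by rewrite sqr_sqrtr.
have sm2 : Num.sqrt m%:R ^+ 2 = m%:R :> R by rewrite sqr_sqrtr.
have x1 : x * Num.sqrt d%:R * Num.sqrt m%:R <= 1 / 4.
  have : rho ^+ 2 * (n%:R * Num.sqrt m%:R / Num.sqrt d%:R) <= 1 / 4.
    apply: le_trans (ler_wpM2r _ rho_le) _.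
      by rewrite divr_ge0 ?mulr_ge0 ?ltW.
    rewrite le_eqVlt; apply/orP; left; apply/eqP.
    by field; rewrite !gt_eqF.
  apply: le_trans; rewrite le_eqVlt; apply/orP; left; apply/eqP.
  have -> : rho ^+ 2 = Num.sqrt d%:R ^+ 2 * a ^+ 2 by rewrite sd2.
  by rewrite /x; field; rewrite gt_eqF.
have sd1 : 1 <= Num.sqrt d%:R :> R.
  by rewrite -[X in X <= _]sqrtr1 ler_wsqrtr// ler1n.
have sm1 : 1 <= Num.sqrt m%:R :> R.
  by rewrite -[X in X <= _]sqrtr1 ler_wsqrtr// ler1n.
(* Since [m] and [d] are at least 1, [x] is at most the product just bounded. *)
have x2 : x <= 1 / 2.
  have h : 1 <= Num.sqrt d%:R * Num.sqrt m%:R :> R by rewrite mulr_ege1.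
  by have := ler_wpM2l x0 h; rewrite mulr1 mulrA; lra.
have c0 : 0 <= (expR x + expR (- x)) / 2 :> R.
  by rewrite divr_ge0 ?addr_ge0 ?expR_ge0.
have := lerXn2r (m * d) c0 (expR_ge0 _) (cosh_le x0 x2).
move=> /le_trans; apply; rewrite -expRM_natl natrM.
have y8 : m%:R * d%:R * (2 * x ^+ 2) <= 1 / 8.
  have -> : m%:R * d%:R * (2 * x ^+ 2) =
      2 * (x * Num.sqrt d%:R * Num.sqrt m%:R) ^+ 2.
    by rewrite !exprMn sd2 sm2; ring.
  have h0 : 0 <= x * Num.sqrt d%:R * Num.sqrt m%:R.
    by rewrite mulr_ge0 ?sqrtr_ge0// mulr_ge0 ?sqrtr_ge0.
  rewrite expr2; nra.
apply: (@le_trans _ _ (expR (1 / 8))); first by rewrite ler_expR.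
have := expR_ge1Dx (- (1 / 8) : R); rewrite expRN => h.
rewrite -(invrK (expR _)) (_ : 1 + 1 / 5 = (5 / 6)^-1); last by field.
rewrite lef_pV2 ?posrE ?invr_gt0 ?expR_gt0//; lra.
Qed.

Theorem theorem4 (R : realType) (M L p q : R)
    (M_gt0 : 0 < M) (L_gt0 : 0 < L) (p_gt0 : 0 < p) (q_gt0 : 0 < q)
    (alpha : R) (alpha_gt0 : 0 < alpha) (alpha_le : alpha <= 1 / 10) :
  exists2 c : R, 0 < c &
    forall (n m d : nat), (0 < n)%N -> (0 < m)%N -> (0 < d)%N ->
    forall (disp : measure_display) (Omega : measurableType disp)
      (P : 'rV[R]_d -> probability Omega R)
      (X : 'I_m -> Omega -> 'rV[R]_d) (U : Omega -> R)
      (fs : 'I_m -> 'rV[R]_d -> R -> R)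
      (C : 'rV[R]_m -> R) (kappa : R -> R),
    gaussian_experiment n P X U ->
    let S := statistic fs X U in
    let T := fun a : R => threshold_test C S (kappa a) in
    (forall j : 'I_m, ('E_(P 0%R)[fun w => `|S j w|%R] <= M%:E)%E) ->
    (forall s s' : 'rV[R]_m,
      `|C s - C s'| <=
        L * (\sum_(j < m) `|s ord0 j - s' ord0 j| `^ p) `^ q) ->
    (forall a b : R, 0 < a -> a < b -> b < 1 -> kappa b < kappa a) ->
    (forall a : R, 0 < a -> a < 1 ->
      (P 0%R [set w | T a w = 1%R] <= a%:E)%E) ->
    (forall j : 'I_m,
      measurable_wrt (sigma_gen (U |` abs_coords (X j))) (S j)) ->
    forall rho : R, 0 < rho ->
    rho ^+ 2 <= c * (Num.sqrt d%:R / (Num.sqrt m%:R * n%:R)) ->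
    ((3 / 4)%:E <=
      ereal_sup [set P f [set w | T alpha w = 0%R] | f in @alternative R d rho])%E.
Proof.
exists (1 / 4); first by lra.
move=> n m d n0 m0 d0 disp Omega P X U fs C kappa gexp S T _ CL _ level mS.
move=> rho rho0 rho_le.
pose a := rho / Num.sqrt d%:R.
have sd : (0 : R) < Num.sqrt d%:R by rewrite sqrtr_gt0 ltr0n.
have rhoE : rho ^+ 2 = d%:R * a ^+ 2.
  by rewrite /a exprMn exprVn sqr_sqrtr// mulrC divfK// gt_eqF// ltr0n.
have altf : alternative rho (const_mx a : 'rV[R]_d).
  rewrite /alternative/= norm2_const ger0_norm; last by rewrite divr_ge0 ?ltW.
  by rewrite /a mulrC divfK ?gt_eqF.
pose E := [set w | kappa alpha <= C (\row_(j < m) S j w)].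
pose G := \bigcup_(g in range (folded_data X U))
  preimage_set_system setT g measurable.
have sE : sigma_gen (range (folded_data X U)) E.
  (* The lemma is applied on [Omega] equipped with the sigma-algebra of the folded data, so that [E]
     is shown to be determined by those data. *)
  apply: (@measurable_rejection _ _ (g_sigma_algebraType G) _ _ _ L p q) => // j.
  move=> _ B mB; rewrite setTI.
  have sub : U |` abs_coords (X j) `<=` range (folded_data X U).
    by move=> _ [->|[i _ <-]]; [exists (inl tt)|exists (inr (j, i))].
  exact: sigma_gen_subset sub _ (mS j B mB).
have lr := @likelihood_ratio_prod _ _ _ (P 0) (P (const_mx a)) _
  (folded_data X U) (folded_data_lr n a) (measurable_folded_data gexp)
  (folded_data_indep gexp 0) (folded_data_indep gexp (const_mx a))
  (measurable_folded_data_lr n a) (folded_data_lr_ge0 n a)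
  (folded_data_likelihood n0 gexp a).
have [mE PE] := lr _ sE.
(* At the whole space the likelihood identity says that [ell] has mean 1 under [P 0]. *)
have [_ PT] := lr setT (@measurableT _ (g_sigma_algebraType G)).
pose ell w := \prod_k folded_data_lr n a k (folded_data X U k w).
have mell : measurable_fun setT ell.
  apply: measurable_prod => k _.
  apply: measurableT_comp (measurable_folded_data_lr _ _ _) _.
  exact: (measurable_folded_data gexp).
have ell0 w : 0 <= ell w by apply: prodr_ge0 => k _; exact: folded_data_lr_ge0.
have ell1 : (\int[P 0%R]_w (ell w)%:E = 1)%E by rewrite -PT probability_setT.
have ell2 : (\int[P 0%R]_w (ell w ^+ 2)%:E <= (1 + 1 / 5)%:E)%E.
  rewrite (folded_data_lr_second_moment n0 gexp a) lee_fin.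
  exact: (folded_data_lr_bound n0 m0 d0 rhoE rho_le).
have TE w : T alpha w = (w \in E)%:R by rewrite /T /threshold_test indicE.
have T1 : [set w | T alpha w = 1] = E.
  apply/seteqP; split=> w /=; last by move=> Ew; rewrite TE mem_set.
  rewrite TE; case: (boolP (w \in E)) => [/set_mem//|_ /eqP].
  by rewrite eq_sym oner_eq0.
have T0 : [set w | T alpha w = 0] = ~` E.
  apply/seteqP; split=> w /=; last by move=> Ew; rewrite TE memNset.
  rewrite TE; case: (boolP (w \in E)) => [_ /eqP|/negP nE _ Ew].
    by rewrite oner_eq0.
  by apply: nE; exact: mem_set.
have P0E : (P 0%R E <= (1 / 10)%:E)%E.
  rewrite -T1; apply: le_trans (level _ alpha_gt0 _) _; first by lra.
  by rewrite lee_fin.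
have PE_le : (P (const_mx a) E <= (1 / 4)%:E)%E.
  apply: le_trans (second_moment_bound mell ell0 mE PE ell1 ell2) _.
  (* The constants balance exactly: [3 / 2 * 1 / 10 + 1 / 10 = 1 / 4]. *)
  apply: (@le_trans _ _ ((3 / 2)%:E * (1 / 10)%:E + (1 / 5 / 2)%:E)%E).
    by rewrite leeD2r// lee_pmul2l// lte_fin; lra.
  by rewrite -EFinM -EFinD lee_fin; lra.
apply: (@le_trans _ _ (P (const_mx a) [set w | T alpha w = 0])).
  rewrite T0 probability_setC// leeBrDr ?fin_num_measure//.
  apply: (@le_trans _ _ ((3 / 4)%:E + (1 / 4)%:E)%E); first by rewrite leeD2l.
  by rewrite -EFinD lee_fin; lra.
by apply: ereal_sup_ubound; exists (const_mx a).
Qed.
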